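(* There are infinitely many isomorphism classes of complex $2$-dimensional compatible commutative associative algebras. They are described explicitly by the following list of $1$ three-parameter family, $3$ two-parameter families, $8$ one-parameter families and $6$ additional algebras. Every nonzero $2$-dimensional compatible commutative associative algebra over $\mathbb{C}$ (with multiplications $\cdot$ and $\ast$) is isomorphic to one and only one of the following algebras with basis $e_1,e_2$, with the exceptions to uniqueness stated after the list (parameters $\alpha,\beta,\gamma$ range over $\mathbb{C}$, subject to the indicated restrictions; products of basis elements not listed are zero): $\mathcal{C}_{03}$: $e_1\ast e_1=e_2$. $\mathcal{C}_{05}^{0}$: $e_1\ast e_1=e_1$. $\mathcal{C}_{06}^{1}$: $e_1\ast e_1=e_1,\ e_1\ast e_2=e_2,\ e_2\ast e_1=e_2$. $\mathcal{C}_{07}$: $e_1\ast e_1=e_1,\ e_2\ast e_2=e_2$. $\mathcal{C}_{13}^{1}$: $e_1\cdot e_1=e_2$; $e_1\ast e_1=e_1,\ e_1\ast e_2=e_2,\ e_2\ast e_1=e_2$. $\mathcal{C}_{15}^{\alpha}$: $e_1\cdot e_1=e_2$; $e_1\ast e_1=\alpha e_2$. $\mathcal{C}_{16}^{0}$: $e_1\cdot e_1=e_2$; $e_1\ast e_1=e_1$. $\mathcal{C}_{18}^{\alpha}$: $e_1\cdot e_1=e_2$; $e_1\ast e_1=\alpha e_2,\ e_1\ast e_2=e_1,\ e_2\ast e_1=e_1,\ e_2\ast e_2=e_2$. $\mathcal{C}_{24}^{0,\beta,0}$: $e_1\cdot e_1=e_1$; $e_1\ast e_1=\beta e_1+e_2$.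 $\mathcal{C}_{25}^{0,\beta,0}$: $e_1\cdot e_1=e_1$; $e_1\ast e_1=\beta e_1$. $\mathcal{C}_{29}^{\alpha}$: $e_1\cdot e_1=e_1$; $e_1\ast e_1=\alpha e_1,\ e_2\ast e_2=e_2$. $\mathcal{C}_{30}^{\alpha,\beta}$: $e_1\cdot e_1=e_1$; $e_1\ast e_1=\alpha e_1+\beta e_2,\ e_1\ast e_2=e_1,\ e_2\ast e_1=e_1,\ e_2\ast e_2=e_2$. $\mathcal{C}_{31}^{1,\beta,\beta}$: $e_1\cdot e_1=e_1,\ e_1\cdot e_2=e_2,\ e_2\cdot e_1=e_2$; $e_1\ast e_1=\beta e_1+e_2,\ e_1\ast e_2=\beta e_2,\ e_2\ast e_1=\beta e_2$. $\mathcal{C}_{32}^{1,\beta,\beta}$: $e_1\cdot e_1=e_1,\ e_1\cdot e_2=e_2,\ e_2\cdot e_1=e_2$; $e_1\ast e_1=\beta e_1,\ e_1\ast e_2=\beta e_2,\ e_2\ast e_1=\beta e_2$. $\mathcal{C}_{34}^{\alpha,\beta}$: $e_1\cdot e_1=e_1,\ e_1\cdot e_2=e_2,\ e_2\cdot e_1=e_2$; $e_1\ast e_1=\alpha e_1,\ e_1\ast e_2=\alpha e_2,\ e_2\ast e_1=\alpha e_2,\ e_2\ast e_2=e_1+\beta e_2$. $\mathcal{C}_{35}^{\alpha}$: $e_1\cdot e_1=e_1,\ e_1\cdot e_2=e_2,\ e_2\cdot e_1=e_2$; $e_1\ast e_1=\alpha e_1,\ e_1\ast e_2=\alpha e_2,\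 e_2\ast e_1=\alpha e_2,\ e_2\ast e_2=e_2$. $\mathcal{C}_{38}^{\alpha,\beta,\gamma}$: $e_1\cdot e_1=e_1,\ e_2\cdot e_2=e_2$; $e_1\ast e_1=(\gamma+\beta-\alpha)e_1-\beta e_2,\ e_1\ast e_2=\alpha e_1+\beta e_2,\ e_2\ast e_1=\alpha e_1+\beta e_2,\ e_2\ast e_2=-\alpha e_1+\gamma e_2$. $\mathcal{C}_{39}^{\alpha,\beta\neq\alpha}$: $e_1\cdot e_1=e_1,\ e_2\cdot e_2=e_2$; $e_1\ast e_1=\alpha e_1,\ e_2\ast e_2=\beta e_2$. All these algebras are pairwise non-isomorphic, except $\mathcal{C}_{38}^{\alpha,\beta,\gamma}\cong\mathcal{C}_{38}^{\beta,\alpha,-\alpha+\beta+\gamma}$ and $\mathcal{C}_{39}^{\alpha,\beta}\cong\mathcal{C}_{39}^{\beta,\alpha}$.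
   Context: All algebras are over $\mathbb{C}$ and all maps are $\mathbb{C}$-linear. A compatible commutative associative algebra is a vector space $\mathbf{A}$ with two bilinear multiplications $\cdot$ and $\ast$ such that $(\mathbf{A},\cdot)$, $(\mathbf{A},\ast)$ and $(\mathbf{A},\cdot+\ast)$ are commutative associative algebras (not necessarily unital). It is nonzero if at least one of the two multiplications is nonzero. An isomorphism of compatible algebras is a linear bijection preserving both multiplications. In multiplication tables, products of basis elements whose value is zero are omitted.
   Formalization: The list of exceptions to pairwise non-isomorphism also includes C_34^{α,β} ≅ C_34^{α,−β} (via e_2 ↦ −e_2), which the stated claim omits and without which uniqueness is false for β ≠ 0. *)

(* Defs.v *)
From HB Require Import structures.
From mathcomp Require Import all_boot all_order all_algebra.
From mathcomp Require Import sesquilinear ring.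
From mathcomp Require Export reals complex.

Set Implicit Arguments.
Unset Strict Implicit.
Unset Printing Implicit Defensive.

Import GRing.Theory.
Local Open Scope ring_scope.

Record double_algebra (F : fieldType) := DoubleAlgebra {
  carrier :> vectType F;
  dot : {bilinear carrier -> carrier -> carrier};
  ast : {bilinear carrier -> carrier -> carrier}
}.

Definition comm_assoc (T : Type) (f : T -> T -> T) : Prop :=
  commutative f /\ associative f.

Definition compatible_comm_assoc (F : fieldType) (A : double_algebra F) : Prop :=
  [/\ comm_assoc (dot A), comm_assoc (ast A)
    & comm_assoc (fun x y : A => dot A x y + ast A x y)].

Definition nonzero (F : fieldType) (A : double_algebra F) : Prop :=
  exists x y : A, dot A x y <> 0 \/ ast A x y <> 0.

Definition two_dimensional (F : fieldType) (A : double_algebra F) : Prop :=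
  \dim (fullv : {vspace A}) = 2%N.

Definition isomorphic (F : fieldType) (A B : double_algebra F) : Prop :=
  exists f : {linear A -> B},
    [/\ bijective f,
        forall x y : A, f (dot A x y) = dot B (f x) (f y)
      & forall x y : A, f (ast A x y) = ast B (f x) (f y)].

Section Table.
Variable F : fieldType.

Definition e1 : 'rV[F]_2 := delta_mx 0 ord0.
Definition e2 : 'rV[F]_2 := delta_mx 0 ord_max.

(* The commutative product with e1 e1 = m11, e1 e2 = e2 e1 = m12 and
   e2 e2 = m22. *)
Definition table (m11 m12 m22 x y : 'rV[F]_2) : 'rV[F]_2 :=
  (x 0 ord0 * y 0 ord0) *: m11
  + (x 0 ord0 * y 0 ord_max + x 0 ord_max * y 0 ord0) *: m12
  + (x 0 ord_max * y 0 ord_max) *: m22.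

Fact table_bilinear (m11 m12 m22 : 'rV[F]_2) :
  bilinear_for *:%R *:%R (table m11 m12 m22).
Proof. by split=> z a x y; apply/rowP => i; rewrite !mxE; ring. Qed.

Fact tableE (m11 m12 m22 x y : 'rV[F]_2) i :
  table m11 m12 m22 x y 0 i =
    x 0 ord0 * y 0 ord0 * m11 0 i
    + (x 0 ord0 * y 0 ord_max + x 0 ord_max * y 0 ord0) * m12 0 i
    + x 0 ord_max * y 0 ord_max * m22 0 i.
Proof. by rewrite !mxE. Qed.

HB.instance Definition _ (m11 m12 m22 : 'rV[F]_2) :=
  bilinear_isBilinear.Build F 'rV[F]_2 'rV[F]_2 'rV[F]_2 *:%R *:%R
    (table m11 m12 m22) (table_bilinear m11 m12 m22).

Definition table_algebra (d11 d12 d22 a11 a12 a22 : 'rV[F]_2) : double_algebra F :=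
  DoubleAlgebra (table d11 d12 d22) (table a11 a12 a22).

End Table.

Arguments e1 {F}.
Arguments e2 {F}.

(* Superscripts that are constant or repeated in the usual notation are
   dropped: C05 is C05^0, C06 is C06^1, C13 is C13^1, C16 is C16^0,
   C24 b is C24^{0,b,0}, C25 b is C25^{0,b,0}, C31 b is C31^{1,b,b} and
   C32 b is C32^{1,b,b}. *)
Inductive label (F : Type) : Type :=
| C03 | C05 | C06 | C07 | C13
| C15 of F | C16 | C18 of F
| C24 of F | C25 of F | C29 of F | C30 of F & F
| C31 of F | C32 of F | C34 of F & F | C35 of F
| C38 of F & F & F | C39 of F & F.

Arguments C03 {F}.
Arguments C05 {F}.
Arguments C06 {F}.
Arguments C07 {F}.
Arguments C13 {F}.
Arguments C16 {F}.

Definition admissible (F : Type) (l : label F) : Prop :=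
  if l is C39 a b then b <> a else True.

(* The arguments of table_algebra are, in this order, the products
   e1.e1, e1.e2, e2.e2 and then e1*e1, e1*e2, e2*e2. *)
Definition alg (F : fieldType) (l : label F) : double_algebra F :=
  match l with
  | C03 => table_algebra 0 0 0 e2 0 0
  | C05 => table_algebra 0 0 0 e1 0 0
  | C06 => table_algebra 0 0 0 e1 e2 0
  | C07 => table_algebra 0 0 0 e1 0 e2
  | C13 => table_algebra e2 0 0 e1 e2 0
  | C15 a => table_algebra e2 0 0 (a *: e2) 0 0
  | C16 => table_algebra e2 0 0 e1 0 0
  | C18 a => table_algebra e2 0 0 (a *: e2) e1 e2
  | C24 b => table_algebra e1 0 0 (b *: e1 + e2) 0 0
  | C25 b => table_algebra e1 0 0 (b *: e1) 0 0
  | C29 a => table_algebra e1 0 0 (a *: e1) 0 e2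
  | C30 a b => table_algebra e1 0 0 (a *: e1 + b *: e2) e1 e2
  | C31 b => table_algebra e1 e2 0 (b *: e1 + e2) (b *: e2) 0
  | C32 b => table_algebra e1 e2 0 (b *: e1) (b *: e2) 0
  | C34 a b => table_algebra e1 e2 0 (a *: e1) (a *: e2) (e1 + b *: e2)
  | C35 a => table_algebra e1 e2 0 (a *: e1) (a *: e2) e2
  | C38 a b c => table_algebra e1 0 e2 ((c + b - a) *: e1 - b *: e2)
                   (a *: e1 + b *: e2) (- a *: e1 + c *: e2)
  | C39 a b => table_algebra e1 0 e2 (a *: e1) 0 (b *: e2)
  end.

(* The swap e1 <-> e2 gives the exceptions for C38 and C39.  The one for C34
   comes from e2 |-> - e2 (lemma C34_opp).  It is missing from the published
   list of exceptions; without it, pairwise non-isomorphism fails over the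
   complex numbers, since C34 a b and C34 a (- b) are distinct entries of the
   list whenever b != 0. *)
Definition exceptional (F : fieldType) (l l' : label F) : Prop :=
  match l with
  | C34 a b => l' = C34 a (- b)
  | C38 a b c => l' = C38 b a (- a + b + c)
  | C39 a b => l' = C39 b a
  | _ => False
  end.

Lemma C34_opp (F : fieldType) (a b : F) :
  isomorphic (alg (C34 a b)) (alg (C34 a (- b))).
Proof.
pose D : 'M[F]_2 := diag_mx (\row_i (if i == ord0 then 1 else -1)).
have fE (x : 'rV[F]_2) i : (x *m D) 0 i = x 0 i * (if i == ord0 then 1 else -1).
  by rewrite mul_mx_diag !mxE.
exists (mulmxr D); split=> [|x y|x y] /=.
- by exists (mulmxr D) => x; apply/rowP => i /=; rewrite !fE;
    case: (i == ord0); ring.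
- apply/rowP => i; rewrite fE !tableE !fE !mxE.
  by case: i => [[|[|//]] p]; rewrite /=; ring.
- apply/rowP => i; rewrite fE !tableE !fE !mxE.
  by case: i => [[|[|//]] p]; rewrite /=; ring.
Qed.

(* Main.v *)
From HB Require Import structures.
Require Import Defs.
From mathcomp Require Import all_boot all_order all_algebra.
From mathcomp Require Import sesquilinear ring.
From mathcomp Require Import reals complex.

(* A product on a plane is determined by its values uu, uv, vv on a basis u, v,
   so an isomorphism onto a table algebra is a basis realizing that table.

   One product: a nonzero idempotent e splits the plane under multiplication by
   e into eigenvectors for 0 and 1, and the complementary vector is normalized
   by completing a square and extracting a square root.  Without idempotents,
   take x with y = xx nonzero: x, y is a basis, and xy = ax + by forces
   a = b = 0, because (y - bx)/a is idempotent when a <> 0 and y/b^2 is when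
   a = 0 and b <> 0.  This leaves five normal forms.

   Two products: put the dot product in normal form.  Subtracting the
   associativity of both products from that of their sum gives linear
   constraints on the second product; what remains is normalized by the
   automorphisms of the normal form.  Pairwise non-isomorphism is read off from
   the same automorphisms, since an isomorphism must preserve the normal form
   of the dot product. *)

Set Implicit Arguments.
Unset Strict Implicit.
Unset Printing Implicit Defensive.

Import GRing.Theory Num.Theory.
Local Open Scope ring_scope.

(** * Transport of structure along isomorphisms *)

Section Isomorphism.
Variable F : fieldType.
Implicit Types A B C : double_algebra F.

Lemma isomorphic_refl A : isomorphic A A.
Proof. by exists idfun; split=> //; exists idfun. Qed.

Lemma isomorphic_sym A B : isomorphic A B -> isomorphic B A.
Proof.
case=> f [[g fK gK] fdot fast].
pose h : {linear B -> A} :=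
  HB.pack g (GRing.isLinear.Build _ _ _ _ g (can2_linear fK gK)).
exists h; split=> [|x y|x y] /=; first by exists f.
- by rewrite -[in LHS](gK x) -[in LHS](gK y) -fdot fK.
- by rewrite -[in LHS](gK x) -[in LHS](gK y) -fast fK.
Qed.

Lemma isomorphic_trans A B C :
  isomorphic A B -> isomorphic B C -> isomorphic A C.
Proof.
case=> f [fbij fdot fast] [g [gbij gdot gast]].
exists (g \o f); split=> [|x y|x y] /=; first exact: bij_comp.
- by rewrite fdot gdot.
- by rewrite fast gast.
Qed.

Lemma comm_assoc_transport (T U : Type) (m : T -> T -> T) (n : U -> U -> U) f :
  bijective f -> {morph f : x y / m x y >-> n x y} ->
  comm_assoc m -> comm_assoc n.
Proof.
case=> g fK gK fM [mC mA]; split=> [x y|x y z].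
- by rewrite -[x]gK -[y]gK -!fM mC.
- by rewrite -[x]gK -[y]gK -[z]gK -!fM mA.
Qed.

Lemma compatible_transport A B :
  isomorphic A B -> compatible_comm_assoc A -> compatible_comm_assoc B.
Proof.
case=> f [fbij fdot fast] [cdot cast csum].
split; [exact: comm_assoc_transport fbij fdot cdot | |].
  exact: comm_assoc_transport fbij fast cast.
by apply: comm_assoc_transport fbij _ csum => x y; rewrite linearD fdot fast.
Qed.

End Isomorphism.

(** An equality is deduced from known ones by naming the multipliers; the remaining polynomial
    identity is left to [ring]. *)
Lemma lincomb1 (R : pzRingType) (x y c l m : R) :
  l = m -> x - y = c * (l - m) -> x = y.
Proof. by move=> ->; rewrite subrr mulr0 => /subr0_eq. Qed.

Lemma lincomb2 (R : pzRingType) (x y c1 c2 l1 m1 l2 m2 : R) :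
  l1 = m1 -> l2 = m2 -> x - y = c1 * (l1 - m1) + c2 * (l2 - m2) -> x = y.
Proof. by move=> -> ->; rewrite !subrr !mulr0 addr0 => /subr0_eq. Qed.

(** * Bases of a plane and multiplication tables *)

Section Frames.
Variable F : fieldType.
Implicit Types (p q r s t w a b x y : 'rV[F]_2).

Lemma row2P x y :
  x = y <-> x 0 ord0 = y 0 ord0 /\ x 0 ord_max = y 0 ord_max.
Proof.
split=> [-> //|[h0 h1]]; apply/rowP; case=> [[|[|//]] p].
- by have -> : Ordinal p = ord0 by apply: val_inj.
- by have -> : Ordinal p = ord_max by apply: val_inj.
Qed.

Lemma row2E x : x = x 0 ord0 *: e1 + x 0 ord_max *: e2.
Proof. by apply/row2P; rewrite !mxE /=; split; ring. Qed.

(** Packed into one tuple, these rules let a single [rewrite] evaluate coordinates. *)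
Lemma row2_coord :
  ((forall i, (0 : 'rV[F]_2) 0 i = 0) *
   (forall x y i, (x + y) 0 i = x 0 i + y 0 i) *
   (forall x i, (- x) 0 i = - x 0 i) *
   (forall c x i, (c *: x) 0 i = c * x 0 i)) *
  (((e1 0 ord0 = 1 :> F) * (e1 0 ord_max = 0 :> F)) *
   ((e2 0 ord0 = 0 :> F) * (e2 0 ord_max = 1 :> F))).
Proof. by do !split=> *; rewrite !mxE. Qed.

Definition comb (V : lmodType F) (u v : V) y : V :=
  y 0 ord0 *: u + y 0 ord_max *: v.

Lemma combE (u v : 'rV[F]_2) y i :
  comb u v y 0 i = y 0 ord0 * u 0 i + y 0 ord_max * v 0 i.
Proof. by rewrite !mxE. Qed.

(** Being a basis is phrased as bijectivity, so that the inverse map supplies coordinates. *)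
Definition frame (V : lmodType F) (u v : V) : Prop := bijective (comb u v).

Definition has_table (V : lmodType F) (m : V -> V -> V) (u v : V) p q r :=
  [/\ m u u = comb u v p, m u v = comb u v q & m v v = comb u v r].

Fact comb_linear (V : lmodType F) (u v : V) : linear (comb u v).
Proof.
move=> c x y; rewrite /comb !mxE !scalerDl scalerDr !scalerA.
by rewrite !addrA; congr (_ + _); rewrite addrAC.
Qed.

HB.instance Definition _ (V : lmodType F) (u v : V) :=
  GRing.isLinear.Build F 'rV[F]_2 V *:%R (comb u v) (comb_linear u v).

Lemma comb_table (V : lmodType F) (m : {bilinear V -> V -> V}) u v p q r :
  commutative m -> has_table m u v p q r ->
  {morph comb u v : x y / table p q r x y >-> m x y}.
Proof.
move=> mC [mp mq mr] x y.
have ml (c d : F) z : m (c *: u + d *: v) z = c *: m u z + d *: m v z.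
  by rewrite linearDl !linearZl_LR.
have mr' (c d : F) z : m z (c *: u + d *: v) = c *: m z u + d *: m z v.
  by rewrite linearDr !linearZr_LR.
rewrite [comb u v x]/comb [comb u v y]/comb ml !mr' (mC v u) mp mq mr.
rewrite [LHS]linearD [X in X + _]linearD !linearZ /= scalerDl.
by rewrite !scalerDr !scalerA !addrA.
Qed.

Definition det2 a b := a 0 ord0 * b 0 ord_max - a 0 ord_max * b 0 ord0.

Lemma frame_det2 a b : frame a b <-> det2 a b != 0.
Proof.
split=> [fr|d0].
  apply: contraTneq (oner_neq0 F) => d0; apply/negPn/eqP.
  have abs y : comb a b y = 0 -> y = 0.
    by move=> y0; apply: (bij_inj fr); rewrite y0 linear0.
  (* With zero determinant, the two cofactor combinations lie in the kernel; hence [a] vanishes, and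
     then [e1] does. *)
  have a0 : b 0 ord0 *: e1 - a 0 ord0 *: e2 = 0 :> 'rV_2.
    apply: abs; apply/row2P; rewrite !combE !mxE /=; split; first by ring.
    by rewrite -[RHS]oppr0 -d0 /det2; ring.
  have a1 : b 0 ord_max *: e1 - a 0 ord_max *: e2 = 0 :> 'rV_2.
    apply: abs; apply/row2P; rewrite !combE !mxE /=; split; last by ring.
    by rewrite -d0 /det2; ring.
  have e10 : e1 = 0 :> 'rV[F]_2.
    apply: abs; apply/row2P; move/row2P: a0; move/row2P: a1.
    rewrite !combE !mxE /= => -[_ h1] [_ h0].
    have -> : a 0 ord0 = 0 by apply/eqP; rewrite -oppr_eq0 -h0; apply/eqP; ring.
    have -> : a 0 ord_max = 0.
      by apply/eqP; rewrite -oppr_eq0 -h1; apply/eqP; ring.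
    by split; ring.
  by move/row2P: e10; rewrite !mxE /= => -[].
(* Cramer's rule gives the inverse. *)
exists (fun y => (det2 y b / det2 a b) *: e1 + (det2 a y / det2 a b) *: e2).
  by move=> y; apply/row2P; rewrite !mxE /= /det2 !combE /=;
    split; rewrite /det2 in d0; field.
by move=> y; apply/row2P; rewrite !combE !mxE /= /det2 /=;
    split; rewrite /det2 in d0; field.
Qed.

Lemma comb_comp (V : lmodType F) (u v : V) a b y :
  comb (comb u v a) (comb u v b) y = comb u v (comb a b y).
Proof. by rewrite [comb a b y]/comb linearD !linearZ. Qed.

Lemma frame_comb (V : lmodType F) (u v : V) a b :
  frame u v -> det2 a b != 0 -> frame (comb u v a) (comb u v b).
Proof.
move=> fr /frame_det2 fr'.
by apply: (eq_bij (bij_comp fr fr')) => y /=; rewrite comb_comp.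
Qed.

Lemma has_table_comb (V : lmodType F) (m : {bilinear V -> V -> V})
    u v p q r a b p' q' r' :
  commutative m -> has_table m u v p q r ->
  has_table (table p q r) a b p' q' r' ->
  has_table m (comb u v a) (comb u v b) p' q' r'.
Proof.
move=> mC /(comb_table mC) mM [mp mq mr].
by split; rewrite -mM comb_comp ?mp ?mq ?mr.
Qed.

Lemma frame_has_table (V : lmodType F) (m : V -> V -> V) u v :
  frame u v -> exists p q r, has_table m u v p q r.
Proof.
case=> g _ gK; exists (g (m u u)), (g (m u v)), (g (m v v)).
by split; rewrite gK.
Qed.

Lemma frame_exists (V : vectType F) :
  \dim (fullv : {vspace V}) = 2%N -> exists u v : V, frame u v.
Proof.
move=> dimV; have := vbasisP (fullv : {vspace V}).
move: (vbasis _); rewrite dimV => b bP.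
exists b`_0, b`_1.
exists (fun z : V => \row_i coord b i z) => [y|z].
  have fb := basis_free bP.
  have cE (i : 'I_2) : coord b i (comb b`_0 b`_1 y) = y 0 i.
    have h0 := coord_free ord0 i fb; have h1 := coord_free ord_max i fb.
    rewrite /= in h0 h1.
    rewrite /comb linearD !linearZ /= h0 h1.
    by case: i {h0 h1} => [[|[|//]] p];
      rewrite /= ?(mulr0, mulr1, addr0, add0r);
      congr (y 0 _); apply: val_inj.
  by apply/rowP => i; rewrite mxE cE.
rewrite [RHS](coord_basis bP (memvf z)) /comb !mxE !big_ord_recl big_ord0 addr0.
by congr (_ + coord b _ z *: _); apply: val_inj.
Qed.

Lemma isomorphic_table p q r s t w (B : double_algebra F) u v :
  commutative (dot B) -> commutative (ast B) -> frame u v ->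
  has_table (dot B) u v p q r -> has_table (ast B) u v s t w ->
  isomorphic (table_algebra p q r s t w) B.
Proof.
move=> dC aC fr dT aT; exists (comb u v); split=> //= x y;
  exact: comb_table.
Qed.

(** Converse of [isomorphic_table]: the images of [e1] and [e2] form the required basis. *)
Lemma table_isomorphic p q r s t w (B : double_algebra F) :
  isomorphic (table_algebra p q r s t w) B ->
  exists u v : B, [/\ frame u v, has_table (dot B) u v p q r &
    has_table (ast B) u v s t w].
Proof.
case=> f [fbij fdot fast].
have fE y : comb (f e1) (f e2) y = f y.
  by rewrite /comb -!linearZ -linearD /= -row2E.
exists (f e1), (f e2); split; first exact: (eq_bij fbij (fsym fE)).
- split; rewrite -fdot fE; congr (f _); apply/row2P;
    by rewrite !tableE !mxE /=; split; ring.
- split; rewrite -fast fE; congr (f _); apply/row2P;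
    by rewrite !tableE !mxE /=; split; ring.
Qed.

Lemma table_comm p q r : commutative (table p q r).
Proof. by move=> x y; apply/row2P; rewrite !tableE; split; ring. Qed.

Lemma table_assocP p q r :
  associative (table p q r) <->
  [/\ p 0 ord_max * r 0 ord0 = q 0 ord0 * q 0 ord_max,
      p 0 ord0 * q 0 ord_max + p 0 ord_max * r 0 ord_max
        = q 0 ord0 * p 0 ord_max + q 0 ord_max ^+ 2
    & p 0 ord0 * r 0 ord0 + q 0 ord0 * r 0 ord_max
        = q 0 ord0 ^+ 2 + q 0 ord_max * r 0 ord0].
Proof.
split=> [assoc|[h1 h2 h3] x y z].
  have /row2P := assoc e1 e1 e2; have /row2P := assoc e2 e2 e1.
  rewrite !tableE !row2_coord => -[h4 h5] [h6 h7].
  split.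
  - by apply: (lincomb1 (c := -1) h6); ring.
  - by apply: (lincomb1 (c := -1) h7); ring.
  - by apply: (lincomb1 (c := -1) h4); ring.
(* The associator changes sign when its arguments are reversed, hence is
   determined by its values at (e1, e1, e2) and (e2, e2, e1). *)
pose c1 := x 0 ord_max * y 0 ord0 * z 0 ord0
  - x 0 ord0 * y 0 ord0 * z 0 ord_max.
pose c2 := x 0 ord0 * y 0 ord_max * z 0 ord_max
  - x 0 ord_max * y 0 ord_max * z 0 ord0.
apply/row2P; rewrite !tableE; split.
  by apply: (lincomb2 (c1 := c1) (c2 := c2) h1 h3); rewrite /c1 /c2; ring.
by apply: (lincomb2 (c1 := c1) (c2 := c2) h2 h1); rewrite /c1 /c2; ring.
Qed.

(** Tables are commutative and a sum of two tables is a table, so only associativity has to be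
    checked. *)
Lemma table_compatibleP p q r s t w :
  compatible_comm_assoc (table_algebra p q r s t w) <->
  [/\ associative (table p q r), associative (table s t w)
    & associative (table (p + s) (q + t) (r + w))].
Proof.
have sumE x y :
    table p q r x y + table s t w x y = table (p + s) (q + t) (r + w) x y.
  by apply/row2P; rewrite mxE !tableE !row2_coord; split; ring.
split=> [[[_ dA] [_ aA] [_ sA]]|[dA aA sA]].
  by split=> // x y z; have := sA x y z; rewrite /= !sumE.
split; [by split; first exact: table_comm | by split; first exact: table_comm|].
split=> [x y|x y z] /=; rewrite !sumE; [exact: table_comm | exact: sA].
Qed.

(** The new basis lies in the source and realizes the table of the target, so the map built from it
    has to be inverted. *)
Lemma table_iso p q r s t w a b p' q' r' s' t' w' :
  det2 a b != 0 ->
  has_table (table p q r) a b p' q' r' ->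
  has_table (table s t w) a b s' t' w' ->
  isomorphic (table_algebra p q r s t w) (table_algebra p' q' r' s' t' w').
Proof.
move=> /frame_det2 fr dT aT; apply/isomorphic_sym.
by apply: (isomorphic_table (B := table_algebra p q r s t w) _ _ fr dT aT);
  exact: table_comm.
Qed.

Lemma alg_compatible (l : label F) : compatible_comm_assoc (alg l).
Proof.
by case: l => [|||||a||a|a|a|a|a b|a|a|a b|a|a b c|a b] /=;
  apply/table_compatibleP; split; apply/table_assocP;
  rewrite !row2_coord; split; ring.
Qed.

Lemma alg_two_dimensional (l : label F) : two_dimensional (alg l).
Proof. by case: l => * ; rewrite /two_dimensional dimvf. Qed.

Lemma alg_nonzero (l : label F) : nonzero (alg l).
Proof.
have e1n : e1 <> 0 :> 'rV[F]_2.
  by move/row2P; rewrite !row2_coord => -[/eqP]; rewrite oner_eq0.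
have e2n : e2 <> 0 :> 'rV[F]_2.
  by move/row2P; rewrite !row2_coord => -[_ /eqP]; rewrite oner_eq0.
have t11 p q r : table p q r e1 e1 = p.
  by apply/row2P; rewrite !tableE !row2_coord; split; ring.
(* In every entry of the list, [e1] has a nonzero square for one of the two products. *)
by case: l => [|||||a||a|a|a|a|a b|a|a|a b|a|a b c|a b]; exists e1, e1;
  rewrite /= !t11; auto.
Qed.

End Frames.

(** * The five normal forms of one product *)

Variant product_kind := Null | Nilpotent | Split_null | Dual | Split_pair.

(** [Dual] is F[x]/(x^2), [Split_pair] is F x F, [Split_null] is F times a null line, and
    [Nilpotent] is the ideal (x) of F[x]/(x^3). *)
Definition kind_rows (F : fieldType) (k : product_kind) :
    'rV[F]_2 * 'rV[F]_2 * 'rV[F]_2 :=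
  match k with
  | Null => (0, 0, 0)
  | Nilpotent => (e2, 0, 0)
  | Split_null => (e1, 0, 0)
  | Dual => (e1, e2, 0)
  | Split_pair => (e1, 0, e2)
  end.

Arguments kind_rows {F}.

Local Notation has_rows m u v T := (has_table m u v T.1.1 T.1.2 T.2).
Local Notation rows_table T := (table T.1.1 T.1.2 T.2).

Tactic Notation "table_rows" :=
  split; apply/row2P; rewrite !tableE ?combE !row2_coord; split.

Tactic Notation "table_rows" constr(H) :=
  split; apply/row2P; rewrite !tableE ?combE !row2_coord ?H; split.

Ltac det_eq c :=
  rewrite (_ : det2 _ _ = c); last by rewrite /det2 !row2_coord; field.

(** * Reduction of one associative product to its normal form *)

Section NormalForm.
Variable F : closedFieldType.
Hypothesis two_neq0 : 2%:R != 0 :> F.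
Implicit Types (p q r s t w a b x y : 'rV[F]_2).

Lemma sqrt_exists (c : F) : exists d, d ^+ 2 = c.
Proof.
(* The monic equation has degree 2, constant term [c] and no linear term. *)
have [d dP] := solve_monicpoly (fun i => if i == 0%N then c else 0) (ltn0Sn 1).
by exists d; rewrite dP !big_ord_recl big_ord0 /=; ring.
Qed.

Definition normalizable p q r :=
  exists k a b, det2 a b != 0 /\ has_rows (table p q r) a b (kind_rows k).

Lemma has_rows_comb (V : lmodType F) (m : {bilinear V -> V -> V})
    u v p q r a b k :
  commutative m -> has_table m u v p q r ->
  has_rows (table p q r) a b (kind_rows k) ->
  has_rows m (comb u v a) (comb u v b) (kind_rows k).
Proof. exact: has_table_comb. Qed.

Lemma det2_comb a b x y : det2 (comb a b x) (comb a b y) = det2 x y * det2 a b.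
Proof. by rewrite /det2 !combE; ring. Qed.

Lemma normalizable_rebase p q r a b p' q' r' :
  det2 a b != 0 -> has_table (table p q r) a b p' q' r' ->
  normalizable p' q' r' -> normalizable p q r.
Proof.
move=> d0 pT [k [x [y [dxy kP]]]]; exists k, (comb a b x), (comb a b y).
split; first by rewrite det2_comb mulf_neq0.
by apply: has_rows_comb pT kP; exact: table_comm.
Qed.

Lemma assoc_rebase p q r a b p' q' r' :
  det2 a b != 0 -> has_table (table p q r) a b p' q' r' ->
  associative (table p q r) -> associative (table p' q' r').
Proof.
move=> /frame_det2 fr /(comb_table (@table_comm F p q r)) mM assoc x y z.
rewrite /= in mM.
by apply: (bij_inj fr); rewrite !mM assoc.
Qed.

(** Multiplication by [e1] acts modulo [e1] by the scalar [q 0 ord_max], which associativity forces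
    to be 0 or 1; if it is 1, then [e1] is a unit. *)
Lemma normalizable_e1 q r :
  associative (table e1 q r) -> normalizable e1 q r.
Proof.
rewrite table_assocP !row2_coord => -[h1 h2 h3].
have [q1|q1] := eqVneq (q 0 ord_max) 0.
  have r0 : r 0 ord0 = q 0 ord0 ^+ 2 - q 0 ord0 * r 0 ord_max.
    by rewrite q1 in h3; apply: (lincomb1 (c := 1) h3); ring.
  (* The vector [e2 - q 0 ord0 *: e1] is annihilated by [e1], and its square is [r 0 ord_max] times
     itself. *)
  have [r1|r1] := eqVneq (r 0 ord_max) 0.
    exists Split_null, e1, (e2 - q 0 ord0 *: e1).
    split; first by det_eq (1 : F); exact: oner_neq0.
    by table_rows (q1, r0, r1); ring.
  exists Split_pair, e1, ((r 0 ord_max)^-1 *: (e2 - q 0 ord0 *: e1)).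
  split; first by det_eq (r 0 ord_max)^-1; rewrite invr_eq0.
  by table_rows (q1, r0); field.
have q0 : q 0 ord0 = 0.
  by apply/eqP; rewrite -(mulIr_eq0 _ (mulIf q1)) -h1 mul0r.
have q1' : q 0 ord_max = 1.
  by apply: (mulIf q1); apply: (lincomb1 (c := -1) h2); rewrite q0; ring.
(* Completing the square: the vector [v] below has square [s ^+ 2 *: e1]. *)
have [s sE] := sqrt_exists (r 0 ord0 + (r 0 ord_max / 2%:R) ^+ 2).
have r0 : r 0 ord0 = s ^+ 2 - (r 0 ord_max / 2%:R) ^+ 2 by rewrite sE addrK.
pose v : 'rV_2 := e2 - (r 0 ord_max / 2%:R) *: e1.
have [s0|s0] := eqVneq s 0.
  exists Dual, e1, v; split.
    by det_eq (1 : F); exact: oner_neq0.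
  by table_rows (q0, q1', r0, s0); field.
(* As [e1] is the unit and [v / s] squares to it, these are two orthogonal idempotents. *)
exists Split_pair, (2%:R^-1 *: (e1 + s^-1 *: v)), (2%:R^-1 *: (e1 - s^-1 *: v)).
split.
  have -> : det2 (2%:R^-1 *: (e1 + s^-1 *: v)) (2%:R^-1 *: (e1 - s^-1 *: v))
    = - (2%:R * s)^-1 by rewrite /det2 !row2_coord; field; rewrite s0.
  by rewrite oppr_eq0 invr_eq0 mulf_neq0.
by table_rows (q0, q1', r0); field; rewrite ?s0 ?two_neq0.
Qed.

Lemma det2_exists x : x != 0 -> exists y, det2 x y != 0.
Proof.
move=> xn0; have [x0|x0] := eqVneq (x 0 ord0) 0.
  exists e1; rewrite /det2 !row2_coord mulr0 mulr1 sub0r oppr_eq0.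
  by apply: contraNneq xn0 => x1; apply/eqP/row2P; rewrite x0 x1 !row2_coord.
by exists e2; rewrite /det2 !row2_coord mulr0 mulr1 subr0.
Qed.

Lemma det2_eq0_scale x y : x != 0 -> det2 x y = 0 -> exists c, y = c *: x.
Proof.
move=> /det2_exists[z]; rewrite /det2 => dz dxy.
(* If [y = c *: x] then [det2 y z = c * det2 x z], which determines [c]. *)
exists (det2 y z / det2 x z); apply/row2P; rewrite !row2_coord /det2.
split; rewrite mulrAC; apply: (canRL (mulfK dz)).
  by apply: (lincomb1 (c := z 0 ord0) dxy); ring.
by apply: (lincomb1 (c := z 0 ord_max) dxy); ring.
Qed.

(** In a basis starting with the idempotent, the first row of the table is [e1]. *)
Lemma normalizable_idempotent p q r x :
  associative (table p q r) -> x != 0 -> table p q r x x = x ->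
  normalizable p q r.
Proof.
move=> assoc /det2_exists[y dxy] xx.
have [p' [q' [r' T]]] :=
  frame_has_table (table p q r) (proj2 (frame_det2 x y) dxy).
have p'E : p' = e1.
  case: T => pE _ _; have /frame_det2 fr := dxy; apply: (bij_inj fr).
  by rewrite -pE xx; apply/row2P; rewrite !combE !row2_coord; split; ring.
rewrite {}p'E in T.
exact: normalizable_rebase dxy T (normalizable_e1 (assoc_rebase dxy T assoc)).
Qed.

Lemma normalizable_e2 q r :
  associative (table e2 q r) -> normalizable e2 q r.
Proof.
move=> assoc; have := assoc; rewrite table_assocP !row2_coord => -[h1 h2 h3].
(* As [e2] is the square of [e1], associativity equates the square of [e2] with [e1] times [q], so
   [q] determines [r]. *)
have r0 : r 0 ord0 = q 0 ord0 * q 0 ord_max by rewrite -h1 mul1r.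
have r1 : r 0 ord_max = q 0 ord0 + q 0 ord_max ^+ 2.
  by apply: (lincomb1 (c := 1) h2); ring.
have [q0|q0] := eqVneq (q 0 ord0) 0; last first.
  (* This witness is the unit: it fixes [e1], and therefore [e2], the square of [e1]. *)
  apply: (@normalizable_idempotent _ _ _
    ((q 0 ord0)^-1 *: (e2 - q 0 ord_max *: e1))) => //.
    apply: contraNneq q0 => /row2P; rewrite !row2_coord => -[_ /eqP].
    by rewrite mulr0 subr0 mulr1 invr_eq0.
  by apply/row2P; rewrite !tableE !row2_coord r0 r1; split; field.
have [q1|q1] := eqVneq (q 0 ord_max) 0.
  exists Nilpotent, e1, e2; split.
    by det_eq (1 : F); exact: oner_neq0.
  by table_rows (q0, q1, r0, r1); ring.
apply: (@normalizable_idempotent _ _ _ ((q 0 ord_max ^+ 2)^-1 *: e2)) => //.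
  apply: contraNneq q1 => /row2P; rewrite !row2_coord => -[_ /eqP].
  by rewrite mulr1 invr_eq0 expf_eq0.
by apply/row2P; rewrite !tableE !row2_coord r0 r1 q0; split; field.
Qed.

Lemma assoc_normalizable p q r :
  associative (table p q r) -> normalizable p q r.
Proof.
move=> assoc.
have t11 : table p q r e1 e1 = p.
  by apply/row2P; rewrite !tableE !row2_coord; split; ring.
have t22 : table p q r e2 e2 = r.
  by apply/row2P; rewrite !tableE !row2_coord; split; ring.
have t12 : table p q r (e1 + e2) (e1 + e2) = p + r + 2%:R *: q.
  by apply/row2P; rewrite !tableE !row2_coord; split; ring.
(* Polarization: if all squares vanish, so do all products, since 2 is nonzero. *)
have [[x xx]|[-> -> ->]] :
    (exists x, table p q r x x != 0) \/ [/\ p = 0, q = 0 & r = 0].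
  have [p0|] := eqVneq p 0; last by left; exists e1; rewrite t11.
  have [r0|] := eqVneq r 0; last by left; exists e2; rewrite t22.
  have [q0|q0] := eqVneq q 0; first by right.
  left; exists (e1 + e2).
  by rewrite t12 p0 r0 !add0r scaler_eq0 negb_or two_neq0.
- set y := table p q r x x in xx *.
  have xn0 : x != 0.
    by apply: contraNneq xx => x0; apply/eqP/row2P;
      rewrite /y x0 !tableE !row2_coord; split; ring.
  (* Either [x] and its square form a basis, or the square is a multiple of [x] and a rescaling of
     [x] is idempotent. *)
  have [dxy|dxy] := eqVneq (det2 x y) 0; last first.
    have [p' [q' [r' T]]] :=
      frame_has_table (table p q r) (proj2 (frame_det2 x y) dxy).
    have p'E : p' = e2.
      case: T => pE _ _; have /frame_det2 fr := dxy; apply: (bij_inj fr).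
      by rewrite -pE -/y; apply/row2P; rewrite !combE !row2_coord; split; ring.
    rewrite {}p'E in T.
    have := normalizable_e2 (assoc_rebase dxy T assoc).
    exact: normalizable_rebase dxy T.
  have [c yE] := det2_eq0_scale xn0 dxy.
  have c0 : c != 0 by apply: contraNneq xx => c0; rewrite yE c0 scale0r.
  apply: (@normalizable_idempotent p q r (c^-1 *: x)) => //.
    by rewrite scaler_eq0 negb_or invr_eq0 c0.
  have -> : table p q r (c^-1 *: x) (c^-1 *: x) = (c^-1 ^+ 2) *: y.
    apply/row2P; rewrite [in RHS]mxE [in RHS]mxE !tableE !row2_coord.
    by split; ring.
  by rewrite yE scalerA; congr (_ *: _); field.
exists Null, e1, e2; split.
  by det_eq (1 : F); exact: oner_neq0.
by table_rows; ring.
Qed.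

End NormalForm.

(** * Every compatible algebra occurs in the list *)

Section Existence.
Variable F : closedFieldType.
Hypothesis two_neq0 : 2%:R != 0 :> F.
Implicit Types (p q r s t w a b x y : 'rV[F]_2) (A B : double_algebra F).

Definition classified A := exists l, admissible l /\ isomorphic A (alg l).

Lemma classified_iso A B : isomorphic A B -> classified B -> classified A.
Proof.
by move=> AB [l [adm Bl]]; exists l; split=> //; exact: isomorphic_trans AB Bl.
Qed.

(** Automorphisms of the first product send [e1] to [k e1 + b e2] and [e2] to [k^2 e2]. The cross
    terms leave [w = t 0 ord0 *: e2], and associativity then kills one coordinate of [t]. *)
Lemma classify_nilpotent s t w :
  compatible_comm_assoc (table_algebra e2 0 0 s t w) ->
  classified (table_algebra e2 0 0 s t w).
Proof.
rewrite table_compatibleP => -[_ /table_assocP[a1 a2 a3] /table_assocP[]].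
rewrite !row2_coord => m1 m2 m3.
have w0 : w 0 ord0 = 0 by apply: (lincomb2 (c1 := 1) (c2 := -1) m1 a1); ring.
have w1 : w 0 ord_max = t 0 ord0.
  by apply: (lincomb2 (c1 := 1) (c2 := -1) m2 a2); ring.
have t01 : t 0 ord0 * t 0 ord_max = 0 by rewrite -a1 w0 mulr0.
have [t0|t0] := eqVneq (t 0 ord0) 0; last first.
  have t1 : t 0 ord_max = 0.
    by move/eqP: t01; rewrite mulf_eq0 (negPf t0) => /eqP.
  (* The scale [k] turns the mixed product into the first basis vector; [b] then cancels the first
     coordinate of that vector's square. *)
  have [k kE] := sqrt_exists (t 0 ord0)^-1.
  have k0 : k != 0 by rewrite -sqrf_eq0 kE invr_eq0.
  have {}t0 : t 0 ord0 = (k ^+ 2)^-1 by rewrite kE invrK.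
  pose b := - (k ^+ 3 * s 0 ord0 / 2%:R).
  exists (C18 (s 0 ord_max + k ^+ 2 * s 0 ord0 ^+ 2 / 4%:R)); split=> //.
  have four_neq0 : 4%:R != 0 :> F by rewrite -[4%N]/(2 * 2)%N natrM mulf_neq0.
  apply: (table_iso (a := k *: e1 + b *: e2) (b := k ^+ 2 *: e2)).
  - by det_eq (k ^+ 3); rewrite expf_neq0.
  - by table_rows; rewrite /b; field; rewrite ?k0.
  - table_rows (w0, w1, t0, t1); rewrite /b; field;
      by rewrite ?k0 ?two_neq0 ?four_neq0.
have [t1|t1] := eqVneq (t 0 ord_max) 0; last first.
  have s0 : s 0 ord0 = t 0 ord_max.
    by apply: (mulIf t1); apply: (lincomb1 (c := 1) a2); rewrite w1 t0; ring.
  exists C13; split=> //.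
  (* The new first vector is idempotent for the second product; its square for the first product is
     the new second vector. *)
  apply: (table_iso (a := (t 0 ord_max)^-1 *: e1
    - (s 0 ord_max / t 0 ord_max ^+ 2) *: e2)
    (b := (t 0 ord_max ^+ 2)^-1 *: e2)).
  - by det_eq (t 0 ord_max ^+ 3)^-1; rewrite invr_eq0 expf_neq0.
  - by table_rows; field.
  - by table_rows (w0, w1, t0, s0); field.
have [s0|s0] := eqVneq (s 0 ord0) 0.
  exists (C15 (s 0 ord_max)); split=> //.
  apply: (table_iso (a := e1) (b := e2)).
  - by det_eq (1 : F); exact: oner_neq0.
  - by table_rows; ring.
  - by table_rows (w0, w1, t0, t1, s0); ring.
exists C16; split=> //.
apply: (table_iso
  (a := (s 0 ord0)^-1 *: e1 + (s 0 ord_max / s 0 ord0 ^+ 2) *: e2)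
  (b := (s 0 ord0 ^+ 2)^-1 *: e2)).
- by det_eq (s 0 ord0 ^+ 3)^-1; rewrite invr_eq0 expf_neq0.
- by table_rows; field.
- by table_rows (w0, w1, t0, t1); field.
Qed.

(** Only [e2] can be rescaled. With [t] along [e1] and [w] along [e2], associativity says that
    [w 0 ord_max - t 0 ord0] annihilates both [s 0 ord_max] and [t 0 ord0]. *)
Lemma classify_split_null s t w :
  compatible_comm_assoc (table_algebra e1 0 0 s t w) ->
  classified (table_algebra e1 0 0 s t w).
Proof.
rewrite table_compatibleP => -[_ /table_assocP[a1 a2 a3] /table_assocP[]].
rewrite !row2_coord => m1 m2 m3.
have t1 : t 0 ord_max = 0 by apply: (lincomb2 (c1 := 1) (c2 := -1) m2 a2); ring.
have w0 : w 0 ord0 = 0 by apply: (lincomb2 (c1 := 1) (c2 := -1) m3 a3); ring.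
have sw : s 0 ord_max * (w 0 ord_max - t 0 ord0) = 0.
  by apply: (lincomb1 (c := 1) a2); rewrite t1; ring.
have [t0|t0] := eqVneq (t 0 ord0) 0; last first.
  have w1 : w 0 ord_max = t 0 ord0.
    by apply: (mulIf t0); apply: (lincomb1 (c := 1) a3); rewrite w0; ring.
  exists (C30 (s 0 ord0) (s 0 ord_max * t 0 ord0)); split=> //.
  apply: (table_iso (a := e1) (b := (t 0 ord0)^-1 *: e2)).
  - by det_eq (t 0 ord0)^-1; rewrite invr_eq0.
  - by table_rows; field.
  - by table_rows (w0, w1, t1); field.
have [w1|w1] := eqVneq (w 0 ord_max) 0; last first.
  have s1 : s 0 ord_max = 0.
    by apply: (mulIf w1); apply: (lincomb1 (c := 1) sw); rewrite t0; ring.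
  exists (C29 (s 0 ord0)); split=> //.
  apply: (table_iso (a := e1) (b := (w 0 ord_max)^-1 *: e2)).
  - by det_eq (w 0 ord_max)^-1; rewrite invr_eq0.
  - by table_rows; field.
  - by table_rows (w0, t0, t1, s1); field.
have [s1|s1] := eqVneq (s 0 ord_max) 0.
  exists (C25 (s 0 ord0)); split=> //.
  apply: (table_iso (a := e1) (b := e2)).
  - by det_eq (1 : F); exact: oner_neq0.
  - by table_rows; ring.
  - by table_rows (w0, w1, t0, t1, s1); ring.
exists (C24 (s 0 ord0)); split=> //.
apply: (table_iso (a := e1) (b := s 0 ord_max *: e2)).
- by det_eq (s 0 ord_max).
- by table_rows; ring.
- by table_rows (w0, w1, t0, t1); ring.
Qed.

(** Only [e2] can be rescaled. The cross terms give [t = s 0 ord0 *: e2], and associativity reduces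
    to [s 0 ord_max *: w = 0]. *)
Lemma classify_dual s t w :
  compatible_comm_assoc (table_algebra e1 e2 0 s t w) ->
  classified (table_algebra e1 e2 0 s t w).
Proof.
rewrite table_compatibleP => -[_ /table_assocP[a1 a2 a3] /table_assocP[]].
rewrite !row2_coord => m1 m2 m3.
have t0 : t 0 ord0 = 0 by apply: (lincomb2 (c1 := -1) (c2 := 1) m1 a1); ring.
have t1 : t 0 ord_max = s 0 ord0.
  by apply: (lincomb2 (c1 := -1) (c2 := 1) m2 a2); ring.
have sw0 : s 0 ord_max * w 0 ord0 = 0 by rewrite a1 t0 mul0r.
have sw1 : s 0 ord_max * w 0 ord_max = 0.
  by apply: (lincomb1 (c := 1) a2); rewrite t0 t1; ring.
have [s1|s1] := eqVneq (s 0 ord_max) 0; last first.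
  have w0 : w 0 ord0 = 0 by move/eqP: sw0; rewrite mulf_eq0 (negPf s1) => /eqP.
  have w1 : w 0 ord_max = 0.
    by move/eqP: sw1; rewrite mulf_eq0 (negPf s1) => /eqP.
  exists (C31 (s 0 ord0)); split=> //.
  apply: (table_iso (a := e1) (b := s 0 ord_max *: e2)).
  - by det_eq (s 0 ord_max).
  - by table_rows; ring.
  - by table_rows (w0, w1, t0, t1); ring.
have [w0|w0] := eqVneq (w 0 ord0) 0; last first.
  (* Scaling [e2] by [k] multiplies this coefficient by [k ^+ 2]; the free sign of [k] is the source
     of the exception for [C34]. *)
  have [k kE] := sqrt_exists (w 0 ord0)^-1.
  have k0 : k != 0 by rewrite -sqrf_eq0 kE invr_eq0.
  have {}w0 : w 0 ord0 = (k ^+ 2)^-1 by rewrite kE invrK.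
  exists (C34 (s 0 ord0) (k * w 0 ord_max)); split=> //.
  apply: (table_iso (a := e1) (b := k *: e2)).
  - by det_eq k.
  - by table_rows; ring.
  - by table_rows (w0, t0, t1, s1); field.
have [w1|w1] := eqVneq (w 0 ord_max) 0; last first.
  exists (C35 (s 0 ord0)); split=> //.
  apply: (table_iso (a := e1) (b := (w 0 ord_max)^-1 *: e2)).
  - by det_eq (w 0 ord_max)^-1; rewrite invr_eq0.
  - by table_rows; field.
  - by table_rows (w0, t0, t1, s1); field.
exists (C32 (s 0 ord0)); split=> //.
apply: (table_iso (a := e1) (b := e2)).
- by det_eq (1 : F); exact: oner_neq0.
- by table_rows; ring.
- by table_rows (w0, w1, t0, t1, s1); ring.
Qed.

(** Nothing is left to normalize except the order of [e1] and [e2]. Unless [t = 0], associativity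
    forces the relation defining [C38]. *)
Lemma classify_split s t w :
  compatible_comm_assoc (table_algebra e1 0 e2 s t w) ->
  classified (table_algebra e1 0 e2 s t w).
Proof.
rewrite table_compatibleP => -[_ /table_assocP[a1 a2 a3] /table_assocP[]].
rewrite !row2_coord => m1 m2 m3.
have s1 : s 0 ord_max = - t 0 ord_max.
  by apply: (lincomb2 (c1 := 1) (c2 := -1) m2 a2); ring.
have w0 : w 0 ord0 = - t 0 ord0.
  by apply: (lincomb2 (c1 := 1) (c2 := -1) m3 a3); ring.
have C38_case : s 0 ord0 = w 0 ord_max + t 0 ord_max - t 0 ord0 ->
    classified (table_algebra e1 0 e2 s t w).
  move=> s0; exists (C38 (t 0 ord0) (t 0 ord_max) (w 0 ord_max)); split=> //.
  apply: (table_iso (a := e1) (b := e2)).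
  - by det_eq (1 : F); exact: oner_neq0.
  - by table_rows; ring.
  - by table_rows (w0, s0, s1); ring.
have [t1|t1] := eqVneq (t 0 ord_max) 0; last first.
  apply: C38_case; apply: (mulIf t1).
  by apply: (lincomb1 (c := 1) a2); rewrite s1; ring.
have [t0|t0] := eqVneq (t 0 ord0) 0; last first.
  apply: C38_case; apply: (mulIf t0).
  by apply: (lincomb1 (c := -1) a3); rewrite w0; ring.
(* With [t = 0] and equal diagonal coefficients the algebra is already a [C38], whence the
   restriction on [C39]. *)
have [s0|s0] := eqVneq (w 0 ord_max) (s 0 ord0).
  by apply: C38_case; rewrite s0 t0 t1; ring.
exists (C39 (s 0 ord0) (w 0 ord_max)); split; first exact/eqP.
apply: (table_iso (a := e1) (b := e2)).
- by det_eq (1 : F); exact: oner_neq0.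
- by table_rows; ring.
- by table_rows (w0, s1, t0, t1); ring.
Qed.

Lemma comm_assoc_kind (V : vectType F) (m : {bilinear V -> V -> V}) :
  \dim (fullv : {vspace V}) = 2%N -> comm_assoc m ->
  exists k u v, frame u v /\ has_rows m u v (kind_rows k).
Proof.
move=> /frame_exists[u [v fr]] [mC mA].
have [p [q [r mT]]] := frame_has_table m fr.
have mM := comb_table mC mT.
have /(assoc_normalizable two_neq0)[k [a [b [dab kP]]]] :
    associative (table p q r).
  by move=> x y z; apply: (bij_inj fr); rewrite /= in mM; rewrite !mM mA.
exists k, (comb u v a), (comb u v b).
by split; [exact: frame_comb | exact: has_rows_comb mT kP].
Qed.

Lemma compatible_classified A :
  compatible_comm_assoc A -> two_dimensional A -> nonzero A -> classified A.
Proof.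
move=> cA dimA nzA; have [[dC dA] [aC aA] _] := cA.
have tableA u v p q r s t w : frame u v -> has_table (dot A) u v p q r ->
    has_table (ast A) u v s t w -> isomorphic A (table_algebra p q r s t w).
  by move=> fr dT aT; apply/isomorphic_sym/(isomorphic_table dC aC fr dT aT).
have [k [u [v [fr]]]] := comm_assoc_kind dimA (conj dC dA).
have [s [t [w aT]]] := frame_has_table (ast A) fr.
case: k => /= dT; last 4 first.
- have iso := tableA _ _ _ _ _ _ _ _ fr dT aT.
  apply: (classified_iso iso); apply: classify_nilpotent.
  exact: compatible_transport iso cA.
- have iso := tableA _ _ _ _ _ _ _ _ fr dT aT.
  apply: (classified_iso iso); apply: classify_split_null.
  exact: compatible_transport iso cA.
- have iso := tableA _ _ _ _ _ _ _ _ fr dT aT.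
  apply: (classified_iso iso); apply: classify_dual.
  exact: compatible_transport iso cA.
- have iso := tableA _ _ _ _ _ _ _ _ fr dT aT.
  apply: (classified_iso iso); apply: classify_split.
  exact: compatible_transport iso cA.
(* A null first product has the zero table in every basis, so the basis can be chosen to normalize
   the second product. *)
have zero_prod (m : {bilinear A -> A -> A}) (z1 z2 x y : A) : commutative m ->
    frame z1 z2 -> has_table m z1 z2 0 0 0 -> m x y = 0.
  move=> mC [g _ gK] /(comb_table mC) /= mM.
  rewrite -[x]gK -[y]gK -mM (_ : table _ _ _ _ _ = 0) ?linear0 //.
  by apply/row2P; rewrite !tableE !row2_coord; split; ring.
have dT' u' v' : has_table (dot A) u' v' 0 0 0.
  by split; rewrite (zero_prod _ _ _ _ _ dC fr dT) linear0.
have [k [u' [v' [fr']]]] := comm_assoc_kind dimA (conj aC aA).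
case: k => /= aT'; last 4 first.
- by exists C03; split=> //; exact: tableA fr' (dT' _ _) aT'.
- by exists C05; split=> //; exact: tableA fr' (dT' _ _) aT'.
- by exists C06; split=> //; exact: tableA fr' (dT' _ _) aT'.
- by exists C07; split=> //; exact: tableA fr' (dT' _ _) aT'.
by case: nzA => x [y [|]]; case;
  [exact: zero_prod fr dT | exact: zero_prod fr' aT'].
Qed.

End Existence.

(** * Isomorphisms between entries of the list *)

Section Uniqueness.
Variable F : fieldType.
Implicit Types (p q r s t w u v x y : 'rV[F]_2) (k : product_kind).

Definition dot_kind (l : label F) :=
  match l with
  | C03 | C05 | C06 | C07 => Null
  | C13 | C15 _ | C16 | C18 _ => Nilpotent
  | C24 _ | C25 _ | C29 _ | C30 _ _ => Split_null
  | C31 _ | C32 _ | C34 _ _ | C35 _ => Dual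
  | C38 _ _ _ | C39 _ _ => Split_pair
  end.

(** Entries with null first product reuse [kind_rows], so that [kind_hom] applies to their second
    product. *)
Definition ast_rows (l : label F) : 'rV[F]_2 * 'rV[F]_2 * 'rV[F]_2 :=
  match l with
  | C03 => kind_rows Nilpotent
  | C05 => kind_rows Split_null
  | C06 => kind_rows Dual
  | C07 => kind_rows Split_pair
  | C13 => (e1, e2, 0)
  | C15 a => (a *: e2, 0, 0)
  | C16 => (e1, 0, 0)
  | C18 a => (a *: e2, e1, e2)
  | C24 b => (b *: e1 + e2, 0, 0)
  | C25 b => (b *: e1, 0, 0)
  | C29 a => (a *: e1, 0, e2)
  | C30 a b => (a *: e1 + b *: e2, e1, e2)
  | C31 b => (b *: e1 + e2, b *: e2, 0)
  | C32 b => (b *: e1, b *: e2, 0)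
  | C34 a b => (a *: e1, a *: e2, e1 + b *: e2)
  | C35 a => (a *: e1, a *: e2, e2)
  | C38 a b c => ((c + b - a) *: e1 - b *: e2, a *: e1 + b *: e2,
                  - a *: e1 + c *: e2)
  | C39 a b => (a *: e1, 0, b *: e2)
  end.

Lemma algE (l : label F) :
  alg l = table_algebra (kind_rows (dot_kind l)).1.1
    (kind_rows (dot_kind l)).1.2 (kind_rows (dot_kind l)).2
    (ast_rows l).1.1 (ast_rows l).1.2 (ast_rows l).2.
Proof. by case: l. Qed.

(* u and v are the images of e1 and e2 under an automorphism of the product
   with rows kind_rows k. *)
Definition automorphic k u v :=
  match k with
  | Null => True
  | Nilpotent =>
    [/\ u 0 ord0 != 0, v 0 ord0 = 0 & v 0 ord_max = u 0 ord0 * u 0 ord0]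
  | Split_null | Dual =>
    [/\ u 0 ord0 = 1, u 0 ord_max = 0, v 0 ord0 = 0 & v 0 ord_max != 0]
  | Split_pair =>
    [/\ u 0 ord0 = 1, u 0 ord_max = 0, v 0 ord0 = 0 & v 0 ord_max = 1] \/
    [/\ u 0 ord0 = 0, u 0 ord_max = 1, v 0 ord0 = 1 & v 0 ord_max = 0]
  end.

Lemma mulf0_or (a b : F) : a * b = 0 -> a = 0 \/ b = 0.
Proof. by move=> /eqP; rewrite mulf_eq0 => /orP[]/eqP; auto. Qed.

Lemma mulf_idem (a : F) : a * a = a -> a = 0 \/ a = 1.
Proof.
move=> aa; have /mulf0_or[|/subr0_eq] : a * (a - 1) = 0; [|by left|by right].
by rewrite mulrBr aa mulr1 subrr.
Qed.

Lemma one_neq_zero : 1 <> 0 :> F.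
Proof. by move/eqP; rewrite oner_eq0. Qed.

Lemma addf_idem (a : F) : a + a = a -> a = 0.
Proof. by move=> aa; apply: (addrI a); rewrite aa addr0. Qed.

Definition ring_units :=
  (mul0r, mulr0, mul1r, mulr1, add0r, addr0, oppr0, subr0).

(** Solves the equations by propagation in a field: zero products and idempotents split into cases,
    known values are substituted, and contradictory branches are closed first. *)
Ltac split_hom_equations :=
  repeat match goal with
  | H : is_true (0 != 0) |- _ => by rewrite eqxx in H
  | H : is_true (?x != 0), E : ?x = 0 |- _ => by rewrite E eqxx in H
  | H : 1 = 0 |- _ => case: (one_neq_zero H)
  | H : ?x = ?x |- _ => clear H
  | H : 0 = 0 |- _ => clear H
  | H : 1 = 1 |- _ => clear H
  | H : 0 = ?x |- _ => symmetry in H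
  | H : 1 = ?x |- _ => symmetry in H
  | H : ?x * ?x = ?x |- _ => case/mulf_idem: H => H
  | H : ?x + ?x = ?x |- _ => move/addf_idem in H
  | H : ?x * ?y = 0 |- _ => case/mulf0_or: H => H
  | H : ?x = _ |- _ => is_var x; subst x
  | H : _ = ?x |- _ => is_var x; subst x
  | H : _ = _ |- _ => rewrite !ring_units in H
  | H : is_true (_ != 0) |- _ => rewrite !ring_units in H
  end.

Lemma has_table_coord u v p q r p' q' r' :
  has_table (table p' q' r') u v p q r ->
  let eq_at i x y l :=
    x 0 ord0 * y 0 ord0 * p' 0 i
    + (x 0 ord0 * y 0 ord_max + x 0 ord_max * y 0 ord0) * q' 0 i
    + x 0 ord_max * y 0 ord_max * r' 0 i
    = l 0 ord0 * u 0 i + l 0 ord_max * v 0 i in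
  [/\ eq_at ord0 u u p /\ eq_at ord_max u u p,
      eq_at ord0 u v q /\ eq_at ord_max u v q
    & eq_at ord0 v v r /\ eq_at ord_max v v r].
Proof.
by case=> /row2P uu /row2P uv /row2P vv; move: uu uv vv; rewrite !tableE !combE.
Qed.

(** All pairs of kinds are solved in coordinates: distinct kinds contradict the nonzero determinant,
    and equal kinds leave exactly the automorphisms. *)
Lemma kind_hom k k' u v :
  det2 u v != 0 -> has_rows (rows_table (kind_rows k')) u v (kind_rows k) ->
  k = k' /\ automorphic k u v.
Proof.
rewrite /det2 => duv /has_table_coord; move: duv.
case: k k' => -[]; rewrite /= ?row2_coord !ring_units;
  move: (u 0 ord0) (u 0 ord_max) (v 0 ord0) (v 0 ord_max) => a b c d duv
    [[h1 h2] [h3 h4] [h5 h6]];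
  split_hom_equations; split=> //; try by [left | right].
(* The entry required to be nonzero divides the determinant. *)
all: by split=> //; apply: contraNneq duv => ->; rewrite mul0r.
Qed.

Lemma alg_hom (l l' : label F) :
  isomorphic (alg l) (alg l') ->
  exists u v, [/\ dot_kind l = dot_kind l', det2 u v != 0,
    automorphic (dot_kind l) u v
    & has_rows (rows_table (ast_rows l')) u v (ast_rows l)].
Proof.
rewrite !algE => /table_isomorphic[u [v [/frame_det2 duv dT aT]]].
by have [kk' aut] := kind_hom duv dT; exists u, v.
Qed.

Lemma nilpotent_unique (l l' : label F) u v :
  2%:R != 0 :> F ->
  dot_kind l = Nilpotent -> dot_kind l' = Nilpotent ->
  automorphic Nilpotent u v ->
  has_rows (rows_table (ast_rows l')) u v (ast_rows l) -> l' = l.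
Proof.
move=> two_neq0.
case: l => [|||||a||a|a|a|a|a b|a|a|a b|a|a b c|a b] // _;
case: l' => [|||||a'||a'|a'|a'|a'|a' b'|a'|a'|a' b'|a'|a' b' c'|a' b'] // _;
move=> [u0 v0 v1] /has_table_coord;
rewrite /= ?row2_coord; rewrite v0 v1 !ring_units => -[[h1 h2] [h3 h4] [h5 h6]];
move: u0 h1 h2 h3 h4 h5 h6;
move: (u 0 ord0) (u 0 ord_max) => {v0 v1} a0 b0 u0 h1 h2 h3 h4 h5 h6;
split_hom_equations => //.
- by congr C15; apply: (mulfI (mulf_neq0 u0 u0)); rewrite h2 mulrC.
(* In [C18], the first coordinate of the square of [u] is [2 a0 b0] and must vanish. *)
have b00 : b0 = 0.
  apply: (mulfI (mulf_neq0 two_neq0 u0)).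
  by apply: (lincomb1 (c := 1) h1); ring.
by congr C18; move: h2; rewrite h6 b00 !ring_units.
Qed.

Lemma split_null_unique (l l' : label F) u v :
  dot_kind l = Split_null -> dot_kind l' = Split_null ->
  automorphic Split_null u v ->
  has_rows (rows_table (ast_rows l')) u v (ast_rows l) -> l' = l.
Proof.
case: l => [|||||a||a|a|a|a|a b|a|a|a b|a|a b c|a b] // _;
case: l' => [|||||a'||a'|a'|a'|a'|a' b'|a'|a'|a' b'|a'|a' b' c'|a' b'] // _;
move=> [u0 u1 v0 dn] /has_table_coord;
rewrite /= ?row2_coord; rewrite u0 u1 v0 !ring_units;
move: dn; move: (v 0 ord_max) => {u0 u1 v0} d dn [[h1 h2] [h3 h4] [h5 h6]];
split_hom_equations => //.
by rewrite mulr1.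
Qed.

Lemma dual_unique (l l' : label F) u v :
  dot_kind l = Dual -> dot_kind l' = Dual -> automorphic Dual u v ->
  has_rows (rows_table (ast_rows l')) u v (ast_rows l) ->
  l' = l \/ exceptional l l'.
Proof.
case: l => [|||||a||a|a|a|a|a b|a|a|a b|a|a b c|a b] // _;
case: l' => [|||||a'||a'|a'|a'|a'|a' b'|a'|a'|a' b'|a'|a' b' c'|a' b'] // _;
move=> [u0 u1 v0 dn] /has_table_coord;
rewrite /= ?row2_coord; rewrite u0 u1 v0 !ring_units;
move: dn; move: (v 0 ord_max) => {u0 u1 v0} d dn [[h1 h2] [h3 h4] [h5 h6]];
split_hom_equations => //; auto.
(* Only [C34] remains: the square of [v] forces [d ^+ 2 = 1], and [d = -1] yields the exception. *)
have b'E : b' = b * d by rewrite -h6 h5 mul1r.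
have /eqP : d ^+ 2 = 1 by rewrite expr2.
rewrite sqrf_eq1 b'E => /orP[]/eqP ->; first by left; rewrite mulr1.
by right; rewrite mulrN1.
Qed.

Lemma split_pair_unique (l l' : label F) u v :
  admissible l -> admissible l' ->
  dot_kind l = Split_pair -> dot_kind l' = Split_pair ->
  automorphic Split_pair u v ->
  has_rows (rows_table (ast_rows l')) u v (ast_rows l) ->
  l' = l \/ exceptional l l'.
Proof.
case: l => [|||||a||a|a|a|a|a b|a|a|a b|a|a b c|a b] // adm;
case: l' => [|||||a'||a'|a'|a'|a'|a' b'|a'|a'|a' b'|a'|a' b' c'|a' b'] //
  adm' _ _;
move=> [|] [u0 u1 v0 v1] /has_table_coord;
rewrite /= ?row2_coord; rewrite u0 u1 v0 v1 !ring_units;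
move=> {u0 u1 v0 v1} [[h1 h2] [h3 h4] [h5 h6]];
split_hom_equations => //; auto.
- by right; congr C38; ring.
(* A [C38] matching a [C39] would make the two parameters of the latter equal. *)
- by case: adm'; ring.
- by case: adm'; ring.
- by case: adm; ring.
- by case: adm; ring.
Qed.

(** The null first product imposes nothing, but the second product is itself a normal form, and its
    kind identifies the label. *)
Lemma null_unique (l l' : label F) u v :
  dot_kind l = Null -> dot_kind l' = Null -> det2 u v != 0 ->
  has_rows (rows_table (ast_rows l')) u v (ast_rows l) -> l' = l.
Proof.
pose ast_kind (l : label F) :=
  match l with
  | C03 => Nilpotent | C05 => Split_null | C06 => Dual | _ => Split_pair
  end.
have astE l0 : dot_kind l0 = Null -> ast_rows l0 = kind_rows (ast_kind l0).
  by case: l0.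
move=> lN l'N duv; rewrite !astE // => /(kind_hom duv)[k_eq _].
by case: l l' lN l'N k_eq => [|||||?||?|?|?|?|? ?|?|?|? ?|?|? ? ?|? ?] [].
Qed.

Lemma alg_unique (l l' : label F) :
  2%:R != 0 :> F -> admissible l -> admissible l' ->
  isomorphic (alg l) (alg l') -> l' = l \/ exceptional l l'.
Proof.
move=> two_neq0 adm adm' /alg_hom[u [v [kk duv aut hom]]].
case lk : (dot_kind l) kk aut => /esym kk aut.
- by left; exact: null_unique hom.
- by left; exact: nilpotent_unique hom.
- by left; exact: split_null_unique hom.
- exact: dual_unique hom.
- exact: split_pair_unique hom.
Qed.

Lemma exceptional_isomorphic (l l' : label F) :
  exceptional l l' -> isomorphic (alg l) (alg l').
Proof.
have swap_det : det2 e2 e1 != 0 :> F.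
  by rewrite /det2 !row2_coord mulr0 mulr1 sub0r oppr_eq0 oner_neq0.
case: l => //= [a b|a b c|a b] ->; first exact: C34_opp.
- by apply: table_iso swap_det _ _; table_rows; ring.
- by apply: table_iso swap_det _ _; table_rows; ring.
Qed.

Lemma alg_isomorphicP (l l' : label F) :
  2%:R != 0 :> F -> admissible l -> admissible l' ->
  isomorphic (alg l) (alg l') <-> l' = l \/ exceptional l l'.
Proof.
move=> two_neq0 adm adm'; split; first exact: alg_unique.
by case=> [->|]; [exact: isomorphic_refl | exact: exceptional_isomorphic].
Qed.

End Uniqueness.

Theorem theoremA2 (R : realType) :
  (exists A : nat -> double_algebra R[i],
     (forall n : nat, compatible_comm_assoc (A n) /\ two_dimensional (A n)) /\
     (forall m n : nat, isomorphic (A m) (A n) -> m = n)) /\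
  (forall l : label R[i], admissible l ->
     [/\ compatible_comm_assoc (alg l), two_dimensional (alg l)
       & nonzero (alg l)]) /\
  (forall A : double_algebra R[i],
     compatible_comm_assoc A -> two_dimensional A -> nonzero A ->
     exists l : label R[i],
       [/\ admissible l, isomorphic A (alg l)
         & forall l' : label R[i], admissible l' -> isomorphic A (alg l') ->
             l' = l \/ exceptional l l']) /\
  (forall l l' : label R[i], admissible l -> admissible l' ->
     (isomorphic (alg l) (alg l') <-> l' = l \/ exceptional l l')).
Proof.
have two_neq0 : 2%:R != 0 :> R[i] by rewrite pnatr_eq0.
split; [|split; [|split]].
(* [C15] has no exceptions, and distinct integers stay distinct in characteristic zero. *)
- exists (fun n => alg (C15 n%:R)); split=> [n|m n].
    by split; [exact: alg_compatible | exact: alg_two_dimensional].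
  by case/alg_unique => // -[/eqP]; rewrite eqr_nat => /eqP.
- move=> l _; split; first exact: alg_compatible.
    exact: alg_two_dimensional.
  exact: alg_nonzero.
- move=> A cA dimA nzA.
  have [l [adm Al]] := compatible_classified two_neq0 cA dimA nzA.
  exists l; split=> // l' adm' Al'; apply: alg_unique => //.
  exact: isomorphic_trans (isomorphic_sym Al) Al'.
- by move=> l l' adm adm'; exact: alg_isomorphicP.
Qed.
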